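(* Let $\Omega=(X_1\times\cdots\times X_n,\ \mu_1\times\cdots\times\mu_n)$ be a finite $n$-wise product probability space, let $(Z,d)$ be a pseudo-metric space, let $f:X_1\times\cdots\times X_n\to Z$, and let $T$ be a deterministic decision tree computing $f$. Then \[ \mathbf{Vr}[f]\le\sum_{i=1}^n\delta_i(T)\,\mathbf{Inf}_i(f). \]
   Context: A pseudo-metric $d$ satisfies all metric axioms except possibly $d(z,z')=0\Rightarrow z=z'$. A deterministic decision tree (DDT) on $X=X_1\times\cdots\times X_n$ is a rooted tree in which each internal node $v$ is labelled by a coordinate $i_v\in[n]$, the arcs leaving $v$ are in bijection with $X_{i_v}$, node labels along each root-leaf path are distinct, and leaves are labelled by elements of $Z$; it computes $f$ if on every input $x$ the leaf reached by following the arcs given by the queried coordinates of $x$ is labelled $f(x)$. $\delta_i(T)=\Pr_{x\sim\mu}[T\text{ queries }x_i]$. The variation is $\mathbf{Vr}[f]=\mathbf{E}_{x,y}[d(f(x),f(y))]$ with $x,y$ independent samples from $\mu$. The influence of coordinate $i$ is $\mathbf{Inf}_i(f)=\mathbf{E}[d(f(x),f(x^{(i)}))]$ where $x\sim\mu$ and $x^{(i)}$ is obtained from $x$ by replacing its $i$th coordinate with an independent sample from $\mu_i$. *)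

(* Defs.v *)
From mathcomp Require Import all_boot all_order all_algebra.
Set Implicit Arguments.
Unset Strict Implicit.
Unset Printing Implicit Defensive.

Import GRing.Theory Num.Theory.
Local Open Scope ring_scope.

(* [d z z' = 0 -> z = z'] is deliberately absent. *)
Record is_pseudo_metric (R : realFieldType) (Z : Type) (d : Z -> Z -> R) :
    Prop := IsPseudoMetric {
  pseudo_metric_ge0 : forall z z', 0 <= d z z';
  pseudo_metric_refl : forall z, d z z = 0;
  pseudo_metric_sym : forall z z', d z z' = d z' z;
  pseudo_metric_triangle : forall z z' z'', d z z'' <= d z z' + d z' z''
}.

(* Points of probability 0 are allowed. *)
Definition is_pmf (R : realFieldType) (A : finType) (p : A -> R) : Prop :=
  (forall a, 0 <= p a) /\ \sum_a p a = 1.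

Definition expect (R : realFieldType) (A : finType) (p F : A -> R) : R :=
  \sum_a p a * F a.

Definition prob (R : realFieldType) (A : finType) (p : A -> R) (E : pred A) : R :=
  \sum_(a | E a) p a.

(* The joint law of a pair of independent samples. *)
Definition indep_pair (R : realFieldType) (A B : finType)
    (p : A -> R) (q : B -> R) (u : A * B) : R :=
  p u.1 * q u.2.

Definition input (n : nat) (X : 'I_n -> finType) : finType :=
  {dffun forall i : 'I_n, X i}.

Definition prod_pmf (R : realFieldType) (n : nat) (X : 'I_n -> finType)
    (mu : forall i, X i -> R) (x : input X) : R :=
  \prod_(i < n) mu i (x i).

Definition set_coord (n : nat) (X : 'I_n -> finType)
    (x : input X) (i : 'I_n) (a : X i) : input X :=
  [ffun j => dfwith x a j].

Definition variation (R : realFieldType) (n : nat) (X : 'I_n -> finType)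
    (mu : forall i, X i -> R) (Z : Type) (d : Z -> Z -> R)
    (f : input X -> Z) : R :=
  expect (indep_pair (prod_pmf mu) (prod_pmf mu)) (fun u => d (f u.1) (f u.2)).

Definition influence (R : realFieldType) (n : nat) (X : 'I_n -> finType)
    (mu : forall i, X i -> R) (Z : Type) (d : Z -> Z -> R)
    (f : input X -> Z) (i : 'I_n) : R :=
  expect (indep_pair (prod_pmf mu) (mu i))
    (fun u => d (f u.1) (f (set_coord u.1 u.2))).

(* Trees in which a coordinate may still be repeated along a path; see
   [is_ddt]. The arcs leaving a node labelled [i] are the elements of [X i]. *)
Inductive dtree (n : nat) (X : 'I_n -> finType) (Z : Type) : Type :=
| Leaf of Z
| Node (i : 'I_n) of (X i -> dtree X Z).

Arguments Leaf {n X Z} _.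
Arguments Node {n X Z} i _.

(* [branch T s]: [s] lists the node labels along some root-leaf path of [T],
   whether or not an input follows that path. *)
Inductive branch (n : nat) (X : 'I_n -> finType) (Z : Type) :
    dtree X Z -> seq 'I_n -> Prop :=
| branch_leaf z : branch (Leaf z) [::]
| branch_node i (c : X i -> dtree X Z) a s :
    branch (c a) s -> branch (Node i c) (i :: s).

Definition is_ddt (n : nat) (X : 'I_n -> finType) (Z : Type)
    (T : dtree X Z) : Prop :=
  forall s, branch T s -> uniq s.

Fixpoint output (n : nat) (X : 'I_n -> finType) (Z : Type)
    (T : dtree X Z) (x : input X) : Z :=
  match T with
  | Leaf z => z
  | Node i c => output (c (x i)) x
  end.

Fixpoint queries (n : nat) (X : 'I_n -> finType) (Z : Type)
    (T : dtree X Z) (x : input X) : seq 'I_n :=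
  match T with
  | Leaf _ => [::]
  | Node i c => i :: queries (c (x i)) x
  end.

Definition computes (n : nat) (X : 'I_n -> finType) (Z : Type)
    (T : dtree X Z) (f : input X -> Z) : Prop :=
  forall x, output T x = f x.

Definition query_prob (R : realFieldType) (n : nat) (X : 'I_n -> finType)
    (mu : forall i, X i -> R) (Z : Type) (T : dtree X Z) (i : 'I_n) : R :=
  prob (prod_pmf mu) (fun x => i \in queries T x).

(* Main.v *)
Require Import Defs.
From mathcomp Require Import all_boot all_order all_algebra.
Set Implicit Arguments.
Unset Strict Implicit.
Unset Printing Implicit Defensive.

Import Order.TTheory GRing.Theory Num.Theory.
Local Open Scope ring_scope.

(** For independent inputs x, y and an arbitrary g,
      E d(T(x), g(y)) <= E d(T(x), g(x)) + \sum_i delta_i(T) Inf_i(g),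
    by induction on T; decoupling the tree from g is what lets the same g be
    used for all subtrees.  At a node labelled i, resample x_i to a value a:
    the subtrees T_a never read x_i, so T(x^(i <- a)) = T_a(x) with a
    independent of x, and the induction hypothesis applies to T_a and g.
    Replacing g(x) by g(x^(i <- a)) then costs Inf_i(g), by the triangle
    inequality.  For g computed by T the first term on the right vanishes. *)

Section Expectation.
Variables (R : realFieldType) (A B : finType).
Implicit Types (p : A -> R) (q : B -> R).

Lemma eq_expect p (F G : A -> R) : F =1 G -> expect p F = expect p G.
Proof. by move=> eFG; apply: eq_bigr => a _; rewrite eFG. Qed.

Lemma expectD p (F G : A -> R) :
  expect p (fun a => F a + G a) = expect p F + expect p G.
Proof. by rewrite -big_split; apply: eq_bigr => a _; rewrite mulrDr. Qed.

Lemma expectMr p (F : A -> R) (r : R) :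
  expect p (fun a => F a * r) = expect p F * r.
Proof. by rewrite [RHS]mulr_suml; apply: eq_bigr => a _; rewrite mulrA. Qed.

Lemma expect_sum p (I : finType) (F : I -> A -> R) :
  expect p (fun a => \sum_i F i a) = \sum_i expect p (F i).
Proof.
by rewrite exchange_big; apply: eq_bigr => a _; rewrite mulr_sumr.
Qed.

Lemma expect_cst p (r : R) : is_pmf p -> expect p (fun=> r) = r.
Proof. by case=> _ p1; rewrite /expect -mulr_suml p1 mul1r. Qed.

Lemma le_expect p (F G : A -> R) :
  is_pmf p -> (forall a, F a <= G a) -> expect p F <= expect p G.
Proof. by case=> p0 _ leFG; apply: ler_sum => a _; rewrite ler_wpM2l. Qed.

Lemma expect_swap p q (F : A -> B -> R) :
  expect p (fun a => expect q (F a)) =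
  expect q (fun b => expect p (fun a => F a b)).
Proof.
rewrite /expect; under eq_bigr do rewrite mulr_sumr.
rewrite exchange_big; apply: eq_bigr => b _; rewrite mulr_sumr.
by apply: eq_bigr => a _; rewrite mulrCA.
Qed.

Lemma expect_indep_pair p q (F : A * B -> R) :
  expect (indep_pair p q) F =
  expect p (fun a => expect q (fun b => F (a, b))).
Proof.
rewrite /expect; under [RHS]eq_bigr do rewrite mulr_sumr.
rewrite pair_big; apply: eq_bigr => -[a b] _ /=.
by rewrite /indep_pair mulrA.
Qed.

Lemma probE p (E : pred A) : prob p E = expect p (fun a => (E a)%:R).
Proof.
by rewrite /prob big_mkcond; apply: eq_bigr => a _; case: (E a);
  rewrite (mulr1, mulr0).
Qed.

End Expectation.

Section Coordinates.
Variables (n : nat) (X : 'I_n -> finType).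
Implicit Types (x : input X) (i j : 'I_n).

Lemma set_coord_in x i (a : X i) : set_coord x a i = a.
Proof. by rewrite ffunE dfwith_in. Qed.

Lemma set_coord_out x i (a : X i) j : j != i -> set_coord x a j = x j.
Proof. by move=> neq_ji; rewrite ffunE dfwith_out // eq_sym. Qed.

(** Keeping the overwritten value makes resampling reversible, hence an involution on pairs of an
    input and a value. *)
Lemma set_coordK x i (a : X i) : set_coord (set_coord x a) (x i) = x.
Proof.
apply/ffunP => j; have [-> | neq_ji] := eqVneq j i.
  by rewrite set_coord_in.
by rewrite !set_coord_out.
Qed.

End Coordinates.

Section ProductMeasure.
Variables (R : realFieldType) (n : nat) (X : 'I_n -> finType).
Variable mu : forall i : 'I_n, X i -> R.
Arguments mu : clear implicits.
Hypothesis mu_pmf : forall i, is_pmf (mu i).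

Lemma prod_pmf_sum :
  \sum_(x : input X) prod_pmf mu x = \prod_(i < n) \sum_(a : X i) mu i a.
Proof.
rewrite (reindex _ (onW_bij _ (dffun_of_fprod_bij X))) /=.
(* Distributivity is applied over tagged pairs, where all coordinates share one type. The default 0
   of [untag] is never reached, since the factor at [i] only ranges over pairs with tag [i]. *)
pose P i := [ffun a : X i => mu i a].
transitivity (\sum_(t : fprod X) \prod_(i < n) P i (t i)).
  by apply: eq_bigr => t _; apply: eq_bigr => i _; rewrite !ffunE.
rewrite big_fprod -(bigA_distr_big_dep _ (fun i => untag 0 (P i))).
apply: eq_bigr => i _; rewrite -(big_tag P).
by apply: eq_bigr => a _; rewrite ffunE.
Qed.

Lemma prod_pmf_is_pmf : is_pmf (prod_pmf mu).
Proof.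
split=> [x|]; first by apply: prodr_ge0 => i _; case: (mu_pmf i).
by rewrite prod_pmf_sum big1 // => i _; case: (mu_pmf i).
Qed.

(** Both sides are [mu i a * mu i (x i)] times the factors at the other coordinates. The
    cross-multiplied form avoids dividing by point masses, which may be 0. *)
Lemma prod_pmf_set_coord (x : input X) i (a : X i) :
  prod_pmf mu (set_coord x a) * mu i (x i) = prod_pmf mu x * mu i a.
Proof.
rewrite /prod_pmf (bigD1 i) // [in RHS](bigD1 i) //= set_coord_in.
rewrite mulrC mulrCA [RHS]mulrC; congr (_ * (_ * _)).
by apply: eq_bigr => j neq_ji; rewrite set_coord_out.
Qed.

(* The involution (x, a) |-> (x^(i <- a), x_i) preserves the joint law of the
   input and of the resampled value. *)
Lemma expect_set_coord i (F : input X -> R) :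
  expect (prod_pmf mu) (fun x => expect (mu i) (fun a => F (set_coord x a))) =
  expect (prod_pmf mu) F.
Proof.
pose s (u : input X * X i) := (set_coord u.1 u.2, u.1 i).
have sK : involutive s.
  by case=> x a; rewrite /s /= set_coordK set_coord_in.
rewrite -(expect_indep_pair _ _ (fun u => F (set_coord u.1 u.2))).
transitivity (expect (indep_pair (prod_pmf mu) (mu i)) (fun u => F u.1)).
  rewrite [RHS](reindex_inj (inv_inj sK)); apply: eq_bigr => -[x a] _ /=.
  by rewrite /indep_pair /= prod_pmf_set_coord.
rewrite expect_indep_pair; apply: eq_expect => x /=.
exact: expect_cst.
Qed.

End ProductMeasure.

Section DecisionTrees.
Variables (n : nat) (X : 'I_n -> finType) (Z : Type).
Implicit Types (T : dtree X Z) (x : input X).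

(** Makes [is_ddt], which speaks of root-leaf paths, applicable to the run of the tree on an
    input. *)
Lemma branch_queries T x : branch T (queries T x).
Proof.
elim: T => [z | i c IHc] /=; first exact: branch_leaf.
exact: branch_node (IHc (x i)).
Qed.

Lemma is_ddt_child i (c : X i -> dtree X Z) a :
  is_ddt (Node i c) -> is_ddt (c a).
Proof. by move=> ddtT s /(branch_node (a := a)) /ddtT /andP[]. Qed.

(** There is no assumption [x i = a]: distinctness holds along every path, so each subtree may be
    run on an arbitrary input. *)
Lemma is_ddt_notin_queries i (c : X i -> dtree X Z) a x :
  is_ddt (Node i c) -> i \notin queries (c a) x.
Proof.
move=> ddtT.
by have /ddtT /andP[] := branch_node (branch_queries (c a) x).
Qed.

Lemma output_set_coord T x i (a : X i) :
  i \notin queries T x -> output T (set_coord x a) = output T x.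
Proof.
elim: T => //= j c IHc; rewrite inE negb_or => /andP[neq_ij i_notin].
by rewrite set_coord_out 1?eq_sym // IHc.
Qed.

Lemma queries_set_coord T x i (a : X i) :
  i \notin queries T x -> queries T (set_coord x a) = queries T x.
Proof.
elim: T => //= j c IHc; rewrite inE negb_or => /andP[neq_ij i_notin].
by rewrite set_coord_out 1?eq_sym // IHc.
Qed.

Lemma output_node_set_coord i (c : X i -> dtree X Z) a x :
  is_ddt (Node i c) -> output (Node i c) (set_coord x a) = output (c a) x.
Proof.
by move=> ddtT; rewrite /= set_coord_in output_set_coord
  ?is_ddt_notin_queries.
Qed.

Lemma queries_node_set_coord i (c : X i -> dtree X Z) a x :
  is_ddt (Node i c) ->
  queries (Node i c) (set_coord x a) = i :: queries (c a) x.
Proof.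
by move=> ddtT; rewrite /= set_coord_in queries_set_coord
  ?is_ddt_notin_queries.
Qed.

End DecisionTrees.

Section Inequality.
Variables (R : realFieldType) (n : nat) (X : 'I_n -> finType).
Variables (mu : forall i : 'I_n, X i -> R) (Z : Type) (d : Z -> Z -> R).
Arguments mu : clear implicits.
Hypotheses (mu_pmf : forall i, is_pmf (mu i)) (d_pm : is_pseudo_metric d).

Let P := prod_pmf mu.

Lemma query_prob_node i (c : X i -> dtree X Z) j :
  is_ddt (Node i c) ->
  query_prob mu (Node i c) j =
  (j == i)%:R + expect (mu i) (fun a => query_prob mu (c a) j).
Proof.
move=> ddtT; rewrite /query_prob probE -(expect_set_coord mu_pmf i).
rewrite expect_swap -[X in X + _](expect_cst _ (mu_pmf i)) -expectD.
apply: eq_expect => a.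
rewrite probE -[X in X + _](expect_cst _ (prod_pmf_is_pmf mu_pmf)) -expectD.
apply: eq_expect => x; rewrite queries_node_set_coord // inE.
(* The two indicators add up without double counting because the subtree does not query [i]
   again. *)
have [-> | _] := eqVneq j i; last by rewrite add0r.
by rewrite (negPf (is_ddt_notin_queries a x ddtT)) addr0.
Qed.

Lemma influenceE (g : input X -> Z) i :
  influence mu d g i =
  expect P (fun x => expect (mu i) (fun a => d (g x) (g (set_coord x a)))).
Proof. exact: expect_indep_pair. Qed.

Lemma dtree_expect_dist_le (g : input X -> Z) (T : dtree X Z) :
  is_ddt T ->
  expect P (fun x => expect P (fun y => d (output T x) (g y))) <=
  expect P (fun x => d (output T x) (g x)) +
    \sum_(j < n) query_prob mu T j * influence mu d g j.
Proof.
have P_pmf : is_pmf P by exact: prod_pmf_is_pmf.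
elim: T => [z _ | i c IHc ddtT].
  (* At a leaf the output is constant, so the two distance terms coincide, and nothing is
     queried. *)
  rewrite /= (expect_cst _ P_pmf) big1 ?addr0 // => j _.
  by rewrite /query_prob probE expect_cst // mul0r.
(* The root is queried with probability 1 and contributes one full influence; the rest is the
   average over the subtrees. *)
have -> : \sum_(j < n) query_prob mu (Node i c) j * influence mu d g j =
    influence mu d g i + expect (mu i) (fun a =>
      \sum_(j < n) query_prob mu (c a) j * influence mu d g j).
  rewrite expect_sum -[influence mu d g i in RHS]mul1r.
  under eq_bigr do rewrite query_prob_node // mulrDl.
  rewrite big_split; congr (_ + _); last first.
    by apply: eq_bigr => j _; rewrite expectMr.
  rewrite (bigD1 i) //= eqxx big1 ?addr0 // => j /negPf->.
  by rewrite mul0r.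
(* Every term becomes an expectation over the resampled value [a], taken outermost, so that the
   comparison can be made for each fixed [a]. *)
rewrite -(expect_set_coord mu_pmf i) expect_swap.
rewrite -[X in X + _](expect_set_coord mu_pmf i) influenceE.
rewrite [X in X + _]expect_swap.
rewrite [X in _ + (X + _)]expect_swap addrA -!expectD.
apply: le_expect => // a; rewrite -expectD.
under eq_expect do rewrite output_node_set_coord //.
apply: le_trans (IHc a (is_ddt_child ddtT)) _; rewrite lerD2r.
apply: le_expect => // x; rewrite output_node_set_coord //.
by rewrite [X in _ + X](pseudo_metric_sym d_pm) pseudo_metric_triangle.
Qed.

End Inequality.

Theorem theorem4 (R : realFieldType) (n : nat) (X : 'I_n -> finType)
    (mu : forall i : 'I_n, X i -> R) (Z : Type) (d : Z -> Z -> R)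
    (f : input X -> Z) (T : dtree X Z)
    (hmu : forall i : 'I_n, is_pmf (mu i))
    (hd : is_pseudo_metric d)
    (hT : is_ddt T)
    (hTf : computes T f) :
  variation mu d f <= \sum_(i < n) query_prob mu T i * influence mu d f i.
Proof.
rewrite /variation expect_indep_pair /=.
have := dtree_expect_dist_le hmu hd f hT.
under eq_expect do under eq_expect do rewrite hTf.
under [X in _ <= X + _]eq_expect do
  rewrite hTf (pseudo_metric_refl hd).
by rewrite (expect_cst _ (prod_pmf_is_pmf hmu)) add0r.
Qed.
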